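(* Let $m,k\in\mathbb N$ and let $\tilde{\lambda}:=\{\lambda_n\}_{n=1}^k\subseteq(0,\infty)$. Put $(\beta\tilde\lambda)_n=\prod_{i=1}^n\lambda_i^2$ for $n\in\{0,\ldots,k\}$. Then: (i) if $k\le m-2$, then there exists $c>0$ such that for every $r\in[c,\infty)$ the sequence $\{\lambda_n\}_{n=1}^{m-1}$ with an arbitrary sequence $\{\lambda_n\}_{n=k+1}^{m-2}\subseteq(0,\infty)$ and $\lambda_{m-1}=r$ admits a strict $m$-isometric completion; (ii) if $k>m-2$, then $\tilde\lambda$ admits an $m$-isometric completion if and only if $\sum_{j=0}^m(-1)^j\binom mj(\beta\tilde\lambda)_{n+j}=0$ for all integers $n$ with $0\le n\le k-m$, and the unique polynomial $w$ of degree at most $m-1$ which satisfies the conditions $w(n)=(\beta\tilde\lambda)_n$ for $n\in\{0,\ldots,m-1\}$ also satisfies $w(n)>0$ for all integers $n\ge m$. Moreover, this completion is strict if and only if the degree of $w$ is equal to $m-1$.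
   Context: $\mathbb N=\{1,2,\ldots\}$, $\mathbb Z_+=\{0,1,2,\ldots\}$; empty products equal $1$. Polynomials are in one indeterminate with real coefficients. Let $\{e_n\}_{n\in\mathbb Z_+}$ be the standard orthonormal basis of $\ell_2$. A bounded operator $S$ on $\ell_2$ is a unilateral weighted shift with weights $\{\lambda_n\}_{n=1}^\infty\subseteq\mathbb C\setminus\{0\}$ (a bounded sequence) if $Se_n=\lambda_{n+1}e_{n+1}$ for all $n\in\mathbb Z_+$. For $m\in\mathbb N$, a bounded operator $T$ on a complex Hilbert space is an $m$-isometry if $\sum_{k=0}^m(-1)^k\binom mk T^{*k}T^k=0$. An $m$-isometry $T$ is called strict if $T$ is an isometry or $m\ge2$ and $T$ is not an $(m-1)$-isometry. A finite sequence $\{\lambda_n\}_{n=1}^{N}\subseteq(0,\infty)$ admits a (strict) $m$-isometric completion if it can be extended to a bounded sequence $\{\lambda_n\}_{n=1}^\infty\subseteq(0,\infty)$ such that the unilateral weighted shift with weights $\{\lambda_n\}_{n=1}^\infty$ is a (strict) $m$-isometry; such a shift is called a (strict) $m$-isometric completion of the finite sequence.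
   Formalization: In (i) the constant c may depend on the arbitrary sequence λ_{k+1},…,λ_{m−2}; ''strict'' is read as: m=1 and T is an isometry, or m≥2 and T is not an (m−1)-isometry, so an isometry is not strict for m≥2. *)

(* Defs.v *)
From HB Require Import structures.
From mathcomp Require Import all_boot all_order all_algebra.
From mathcomp Require Import complex.
From mathcomp Require Import all_classical all_reals all_analysis.
From mathcomp Require Import ring lra.

Set Implicit Arguments.
Unset Strict Implicit.
Unset Printing Implicit Defensive.

Import Order.TTheory GRing.Theory Num.Theory.
Import numFieldNormedType.Exports.
Local Open Scope classical_set_scope.
Local Open Scope ring_scope.
Local Open Scope complex_scope.

Section ComplexSeries.
Variable R : realType.
Implicit Types (z : R[i]) (u v : nat -> R[i]).

Lemma normc_sqr z : Normc.normc z ^+ 2 = complex.Re z ^+ 2 + complex.Im z ^+ 2.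
Proof. by case: z => a b /=; rewrite sqr_sqrtr// addr_ge0// sqr_ge0. Qed.

Lemma normc_ge0 z : 0 <= Normc.normc z.
Proof. by case: z => a b /=; exact: sqrtr_ge0. Qed.

Lemma normc_sqrD z1 z2 : Normc.normc (z1 + z2) ^+ 2 <=
  2 * Normc.normc z1 ^+ 2 + 2 * Normc.normc z2 ^+ 2.
Proof.
rewrite !normc_sqr; case: z1 z2 => a b [c d] /=.
by have := sqr_ge0 (a - c); have := sqr_ge0 (b - d); nra.
Qed.

Lemma cvg_real_complex (f : nat -> R) (l : R) : f @ \oo --> l ->
  (fun n => (f n)%:C : R[i]^o) @ \oo --> (l%:C : R[i]^o).
Proof.
move=> /cvgrPdist_lt fl; apply/cvgrPdist_lt => e.
case: e => e e'; rewrite ltcE /= => /andP[/eqP -> e0].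
near=> n; rewrite -[X in `|X|]rmorphB/= normc_def/= expr0n/= addr0 sqrtr_sqr ltcR.
by near: n; exact: fl.
Unshelve. all: by end_near. Qed.

Lemma cvg_conjc (f : nat -> R[i]) (l : R[i]) :
  (f : nat -> R[i]^o) @ \oo --> (l : R[i]^o) ->
  (fun n => conjc (f n) : R[i]^o) @ \oo --> (conjc l : R[i]^o).
Proof.
move=> /cvgrPdist_lt fl; apply/cvgrPdist_lt => e e0.
near=> n; rewrite -[X in `|X|]rmorphB/= normcJ.
by near: n; exact: fl.
Unshelve. all: by end_near. Qed.

Lemma is_cvg_series_complex u :
  cvgn (series (fun n => Normc.normc (u n))) ->
  cvgn (series (u : nat -> R[i]^o)).
Proof.
move=> cu.
have cRe : cvgn (series (fun n => complex.Re (u n))).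
  apply: (@normed_cvg R R); apply: series_le_cvg cu => n //=.
    exact: normc_ge0.
  by have := normc_ge_Re (u n); rewrite normc_def lecR; case: (u n).
have cIm : cvgn (series (fun n => complex.Im (u n))).
  apply: (@normed_cvg R R); apply: series_le_cvg cu => n //=.
    exact: normc_ge0.
  case: (u n) => a b /=; rewrite -sqrtr_sqr ler_wsqrtr// lerDr.
  exact: sqr_ge0.
have -> : series (u : nat -> R[i]^o) =
    (fun n => (series (fun n => complex.Re (u n)) n)%:C
       + ('i : R[i]) * (series (fun n => complex.Im (u n)) n)%:C : R[i]^o).
  apply/funext => n; rewrite /series/= !rmorph_sum mulr_sumr -big_split/=.
  by apply: eq_bigr => j _; rewrite [LHS]complexE.
apply/cvg_ex; eexists; apply: cvgD; first exact: cvg_real_complex cRe.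
by apply: cvgM; [exact: cvg_cst | exact: cvg_real_complex cIm].
Qed.

End ComplexSeries.

Section Ell2.
Variable R : realType.

Definition square_summable : {pred nat -> R[i]} :=
  [pred x | `[< cvgn (series (fun n => Normc.normc (x n) ^+ 2)) >]].

Lemma square_summable_submod_closed : submod_closed square_summable.
Proof.
split=> [|a x y /asboolP cx /asboolP cy]; apply/asboolP.
  apply/cvg_ex; exists 0; apply: cvg_near_cst; apply: nearW => n.
  by apply: big1 => j _; rewrite normc_sqr/= expr0n addr0.
pose b := Normc.normc a ^+ 2.
apply: (@series_le_cvg _ _ (fun n =>
    (2 * b) * Normc.normc (x n) ^+ 2 + 2 * Normc.normc (y n) ^+ 2)).
- by move=> n; exact: sqr_ge0.
- move=> n; apply: addr_ge0; last by rewrite mulr_ge0 ?sqr_ge0.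
  by apply: mulr_ge0 (sqr_ge0 _); apply: mulr_ge0 (sqr_ge0 _).
- move=> n; apply: le_trans (normc_sqrD _ _) _.
  by rewrite Normc.normcM exprMn mulrA.
- rewrite -[X in series X]/((2 * b) *: (fun n => Normc.normc (x n) ^+ 2) +
      2 *: (fun n => Normc.normc (y n) ^+ 2)).
  by apply: is_cvg_seriesD; exact: is_cvg_seriesZ.
Qed.

HB.instance Definition _ := GRing.isSubmodClosed.Build _ _ square_summable
  square_summable_submod_closed.

Record ell2 := Ell2 {
  ell2_seq :> nat -> R[i];
  ell2P : ell2_seq \in square_summable }.

HB.instance Definition _ := [isSub for ell2_seq].
HB.instance Definition _ := [Choice of ell2 by <:].
HB.instance Definition _ := [SubChoice_isSubLmodule of ell2 by <:].

Definition ell2_dot (x y : ell2) : R[i] :=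
  limn (series (fun n => x n * (y n)^*%R : R[i]^o)).

Lemma is_cvg_ell2_dot (x y : ell2) :
  cvgn (series (fun n => x n * (y n)^*%R : R[i]^o)).
Proof.
apply: is_cvg_series_complex.
have /asboolP cx := ell2P x; have /asboolP cy := ell2P y.
apply: (@series_le_cvg _ _ (fun n =>
    Normc.normc (x n) ^+ 2 + Normc.normc (y n) ^+ 2)).
- by move=> n; exact: normc_ge0.
- by move=> n; rewrite addr_ge0// sqr_ge0.
- move=> n; rewrite Normc.normcM.
  rewrite (_ : Normc.normc (y n)^*%R = Normc.normc (y n)); last first.
    by case: (y n) => a b /=; rewrite sqrrN.
  have := normc_ge0 (x n); have := normc_ge0 (y n).
  by have := sqr_ge0 (Normc.normc (x n) - Normc.normc (y n)); nra.
- rewrite -[X in series X]/((fun n => Normc.normc (x n) ^+ 2) +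
      (fun n => Normc.normc (y n) ^+ 2)).
  exact: is_cvg_seriesD.
Qed.

Lemma ell2_dotC x y : ell2_dot x y = (ell2_dot y x)^*%R.
Proof.
rewrite /ell2_dot; apply: (@cvg_lim R[i]^o); first exact: norm_hausdorff.
rewrite (_ : series _ = fun n => conjc (series (fun n => y n * (x n)^*%R) n)).
  by apply: cvg_conjc; exact: is_cvg_ell2_dot.
apply/funext => n; rewrite /series/= rmorph_sum/=; apply: eq_bigr => j _.
rewrite mulrC -[LHS]conjCK; congr (_ ^*%R).
by rewrite rmorphM/= conjCK.
Qed.

Lemma ell2_dot_linearl y : scalar (ell2_dot ^~ y).
Proof.
move=> a x z; rewrite /ell2_dot.
apply: (@cvg_lim R[i]^o); first exact: norm_hausdorff.
rewrite (_ : series _ = fun n => (a * series (fun n => x n * (y n)^*%R) n +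
    series (fun n => z n * (y n)^*%R) n : R[i]^o)).
  apply: cvgD; last exact: is_cvg_ell2_dot.
  by apply: cvgM; [exact: cvg_cst|exact: is_cvg_ell2_dot].
apply/funext => n; rewrite /series/= mulr_sumr -big_split/=.
by apply: eq_bigr => j _; rewrite mulrDl mulrA.
Qed.

Lemma ell2_dot_is_bilinear : bilinear_for
  (GRing.Scale.Law.clone _ _ *%R _)
  (GRing.Scale.Law.clone _ _ (Num.conj \; *%R) _) ell2_dot.
Proof.
split=> [y|x]; first exact: ell2_dot_linearl.
move=> a y z; rewrite ell2_dotC ell2_dot_linearl rmorphD rmorphM/=.
by rewrite -!ell2_dotC.
Qed.

HB.instance Definition _ :=
  bilinear_isBilinear.Build _ _ _ _ _ _ ell2_dot ell2_dot_is_bilinear.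

Lemma ell2_dot_hermitian x y :
  ell2_dot x y = (-1) ^+ false * (ell2_dot y x)^*%R.
Proof. by rewrite mul1r; exact: ell2_dotC. Qed.

HB.instance Definition _ :=
  isHermitianSesquilinear.Build _ _ _ _ ell2_dot ell2_dot_hermitian.

Lemma ell2_dotE x :
  ell2_dot x x = (limn (series (fun n => Normc.normc (x n) ^+ 2)))%:C.
Proof.
rewrite /ell2_dot; apply: (@cvg_lim R[i]^o); first exact: norm_hausdorff.
have /asboolP cx := ell2P x.
rewrite (_ : series _ = fun n => (series (fun n => Normc.normc (x n) ^+ 2) n)%:C).
  exact: cvg_real_complex cx.
apply/funext => n; rewrite /series/= rmorph_sum/=; apply: eq_bigr => j _.
by rewrite -normCK normc_def -rmorphXn; case: (x j).
Qed.

Lemma ell2_dot_gt0 x : x != 0 -> 0 < ell2_dot x x.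
Proof.
move=> x0; rewrite ell2_dotE ltcR.
have [n xn0] : exists n, x n != 0.
  apply/not_existsP => x_0; move/eqP: x0; apply; apply/val_inj/funext => n.
  by apply/eqP; apply/negP => /negP /x_0.
have /asboolP cx := ell2P x.
have nd : nondecreasing_seq (series (fun n => Normc.normc (x n) ^+ 2)).
  by apply: nondecreasing_series => j _ _; exact: sqr_ge0.
apply: lt_le_trans (nondecreasing_cvgn_le nd cx n.+1).
rewrite /series/= big_nat_recr//= ltr_wpDl//.
  by rewrite sumr_ge0// => j _; exact: sqr_ge0.
rewrite lt_def sqr_ge0 andbT sqrf_eq0.
by apply/eqP => /Normc.eq0_normc; apply/eqP.
Qed.

HB.instance Definition _ := isDotProduct.Build _ _ ell2_dot ell2_dot_gt0.

Lemma delta_square_summable (n : nat) :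
  (fun j => (j == n)%:R : R[i]) \in square_summable.
Proof.
apply/asboolP; apply/cvg_ex; exists 1; apply: cvg_near_cst.
exists n.+1 => // j /= nj; apply: (@etrans _ _ (\sum_(0 <= i < j) (i == n)%:R)).
  apply: eq_bigr => i _; case: (i == n) => /=.
  by rewrite expr1n expr0n addr0 sqrtr1 expr1n.
  by rewrite !expr0n addr0 sqrtr0 expr0n.
rewrite big_mkord (bigD1 (Ordinal nj))//= eqxx big1 ?addr0// => i.
by rewrite -val_eqE/= => /negbTE ->.
Qed.

Definition ell2_basis (n : nat) : ell2 := Ell2 (delta_square_summable n).

End Ell2.

Section Operators.
Variables (C : numClosedFieldType) (H : lmodType C) (dot : {dot H for Num.conj}).
Implicit Types T : {linear H -> H}.

Definition bounded_op T :=
  exists M : C, forall x, sqrtC (dot (T x) (T x)) <= M * sqrtC (dot x x).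

Definition adjoint_op T T' := forall x y, dot (T x) y = dot x (T' y).

(* The operator T' below is the adjoint of T: it is unique, and it exists for
   every bounded T as soon as H is complete, in particular for ell2. *)
Definition m_isometry (m : nat) T := bounded_op T /\
  exists T' : {linear H -> H}, [/\ bounded_op T', adjoint_op T T' &
    forall x, \sum_(j < m.+1)
      ((-1) ^+ j * 'C(m, j)%:R) *: iter j T' (iter j T x) = 0].

(* The alternative "T is an isometry" belongs to the case m = 1 only: for
   m >= 2 an isometry is an m-isometry that is not strict. *)
Definition strict_m_isometry (m : nat) T := m_isometry m T /\
  ((m = 1%N /\ isometry dot dot T) \/
   ((2 <= m)%N /\ ~ m_isometry m.-1 T)).

End Operators.

Section Shifts.
Variable R : realType.
Implicit Types S : {linear ell2 R -> ell2 R}.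

(* Weights lambda_1, lambda_2, ... are numbered from 0 here: lambda_(n+1) is
   lam n, or s`_n in a finite sequence s. *)
Definition unilateral_weighted_shift (lam : nat -> R[i]) S :=
  [/\ bounded_op (@ell2_dot R) S,
      forall n, lam n != 0,
      exists M : R[i], forall n, `|lam n| <= M &
      forall n, S (ell2_basis R n) = lam n *: ell2_basis R n.+1].

Definition shift_completion (s : seq R) S := exists lam : nat -> R,
  [/\ forall n, 0 < lam n,
      forall n, (n < size s)%N -> lam n = s`_n &
      unilateral_weighted_shift (fun n => (lam n)%:C) S].

Definition m_isometric_completion (m : nat) (s : seq R) S :=
  shift_completion s S /\ m_isometry (@ell2_dot R) m S.

Definition strict_m_isometric_completion (m : nat) (s : seq R) S :=
  shift_completion s S /\ strict_m_isometry (@ell2_dot R) m S.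

Definition beta (s : seq R) (n : nat) : R := \prod_(i < n) s`_i ^+ 2.

Definition interpolates (m : nat) (b : nat -> R) (w : {poly R}) :=
  (size w <= m)%N /\ forall n, (n < m)%N -> w.[n%:R] = b n.

End Shifts.

(* Main.v *)
Require Import Defs.
From HB Require Import structures.
From mathcomp Require Import all_boot all_order all_algebra.
From mathcomp Require Import complex.
From mathcomp Require Import all_classical all_reals all_analysis.
From mathcomp Require Import polyrcf.
From mathcomp Require Import ring lra.

(** Write beta_n for the product of the first n squared weights of a positive
weighted shift S. In the standard basis the operator S^{*j} S^j is diagonal
with entries beta_{n+j} / beta_n, so S is an m-isometry exactly when the m-th
difference of the sequence beta vanishes ([m_isometry_sum_eq0]), that is, when
n |-> beta_n is a polynomial of degree less than m. This turns both parts into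
statements on polynomials positive on the natural numbers.

For (ii), an m-isometric completion has beta_n = w(n) for all n, where w is the
polynomial through the first m values; this forces the difference equations on
the prescribed values and the positivity of w. Conversely, if they hold, the
weights sqrt (w(n+1) / w(n)) extend the given ones, and they are bounded since
w(n+1) <= M w(n) for a polynomial w positive on the natural numbers
([ratio_bounded]); the backward shift with the same weights is the adjoint.
For m >= 2 the completion is an (m-1)-isometry exactly when w has degree less
than m-1 ([strict_m_isometry_size]).

For (i), the sequence extended up to index m-1 is in the range of (ii), with no
difference equation to check. In Newton form w is the interpolation polynomial
of the values preceding the last one plus a multiple a of the binomial
polynomial of degree m-1, where a tends to infinity with r. For n >= m-1 this
binomial dominates the lower ones ([leq_bin_fact]), hence for large r the
polynomial w is positive there and has degree exactly m-1. *)

Set Implicit Arguments.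
Unset Strict Implicit.
Unset Printing Implicit Defensive.

Import Order.TTheory GRing.Theory Num.Theory.
Import numFieldNormedType.Exports.
Local Open Scope ring_scope.

(** * Forward differences *)

Section ForwardDifferences.
Variable F : comPzRingType.
Implicit Types (f g : nat -> F) (c : F) (m n N : nat).

Definition fdiff f n : F := f n.+1 - f n.

Lemma eq_iter_fdiff m f g :
  (forall n, f n = g n) -> forall n, iter m fdiff f n = iter m fdiff g n.
Proof.
by move=> fg; elim: m => [//|m IHm] n; rewrite !iterS /fdiff !IHm.
Qed.

Lemma iter_fdiff0 m n : iter m fdiff (fun=> 0) n = 0.
Proof. by elim: m n => [//|m IHm] n; rewrite iterS /fdiff !IHm subr0. Qed.

Lemma iter_fdiffZ m c f n :
  iter m fdiff (fun k => c * f k) n = c * iter m fdiff f n.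
Proof. by elim: m n => [//|m IHm] n; rewrite !iterS /fdiff !IHm mulrBr. Qed.

Lemma iter_fdiff_sum m (I : Type) (r : seq I) (f : I -> nat -> F) n :
  iter m fdiff (fun k => \sum_(i <- r) f i k) n =
  \sum_(i <- r) iter m fdiff (f i) n.
Proof.
by elim: m n => [//|m IHm] n; rewrite iterS /fdiff !IHm -sumrB.
Qed.

(** The alternating sums defining m-isometries are, up to sign, iterated
differences, for which inductions on the order are immediate. The inductive
step is Pascal's rule. *)
Lemma alternating_sum_fdiff m f n :
  \sum_(j < m.+1) (-1) ^+ j * 'C(m, j)%:R * f (n + j)%N =
  (-1) ^+ m * iter m fdiff f n.
Proof.
elim: m n => [|m IHm] n; first by rewrite big_ord1 /= !expr0 !mul1r addn0.
have pascal (j : nat) : (-1) ^+ j.+1 * 'C(m.+1, j.+1)%:R * f (n + j.+1)%N =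
    (-1) ^+ j.+1 * 'C(m, j.+1)%:R * f (n + j.+1)%N -
    (-1) ^+ j * 'C(m, j)%:R * f (n.+1 + j)%N.
  by rewrite binS natrD addnS -addSn exprS; ring.
rewrite big_ord_recl; under eq_bigr => j _ do rewrite lift0 pascal.
rewrite sumrB IHm addrA.
have -> : (-1) ^+ (@ord0 m.+1) * 'C(m.+1, @ord0 m.+1)%:R *
      f (n + @ord0 m.+1)%N +
    \sum_(i < m.+1) (-1) ^+ i.+1 * 'C(m, i.+1)%:R * f (n + i.+1)%N =
    (-1) ^+ m * iter m fdiff f n.
  rewrite -IHm [in RHS]big_ord_recl big_ord_recr/= !bin0 bin_small//.
  by rewrite mulr0 mul0r addr0.
by rewrite iterS /fdiff exprS; ring.
Qed.

(** Newton's forward formula. Since f(n+1) = f(n) + (fdiff f)(n), the induction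
on n combines the expansions of f and of its difference by Pascal's rule. The
number m of terms is free because 'C(n, j) = 0 for j > n. *)
Lemma newton_forward m f n : (n < m)%N ->
  f n = \sum_(j < m) iter j fdiff f 0 * 'C(n, j)%:R.
Proof.
elim: n m f => [|n IHn] [//|m] f nm.
  by rewrite big_ord_recl/= mulr1 big1 ?addr0// => j _; rewrite mulr0.
rewrite -[LHS](subrK (f n)) [X in _ + X](IHn m.+1) ?(ltnW nm)//.
rewrite [X in _ + X]big_ord_recl [RHS]big_ord_recl !bin0 addrCA.
congr (_ + _); under [RHS]eq_bigr => j _ do rewrite lift0 binS natrD mulrDr.
rewrite big_split/= addrC; congr (_ + _).
rewrite -/(fdiff f n) (IHn m)//; apply: eq_bigr => j _.
by rewrite -iterSr.
Qed.

(** Differencing lowers the order of a binomial coefficient by one, by Pascal's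
rule, until it becomes constant and then zero. *)
Lemma iter_fdiff_bin m j n : (j < m)%N ->
  iter m fdiff (fun k => 'C(k, j)%:R) n = 0.
Proof.
elim: m j => // m IHm [|j] jm; rewrite iterSr; under eq_iter_fdiff => k.
- rewrite /fdiff !bin0 subrr; over.
- exact: iter_fdiff0.
- rewrite /fdiff binS natrD addrAC subrr add0r; over.
- exact: IHm.
Qed.

(** A sequence solves an m-th order recurrence once its m-th difference is
given, so its first m values determine it. The bound N is there for finite
sequences, which are meaningful only up to their size. *)
Lemma iter_fdiff_inj m N f g :
  (forall n, (n < m)%N -> f n = g n) ->
  (forall n, (n + m <= N)%N -> iter m fdiff f n = iter m fdiff g n) ->
  forall n, (n <= N)%N -> f n = g n.
Proof.
elim: m N f g => [|m IHm] N f g init eqd n nN.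
  by apply: eqd; rewrite addn0.
elim: n nN => [|n IHn] nN; first exact: init.
rewrite -[LHS](subrK (f n)) -[RHS](subrK (g n)).
congr (_ + _); last exact: IHn (ltnW nN).
case: N nN eqd {IHn} => // N nN eqd.
rewrite -/(fdiff f n) -/(fdiff g n).
apply: (IHm N (fdiff f) (fdiff g)) => // [i im|i iN].
  by rewrite /fdiff !init// ltnW.
by rewrite -!iterSr eqd// addnS.
Qed.

End ForwardDifferences.

(** * Newton interpolation at the natural numbers *)

Section NewtonPolynomials.
Variable F : numFieldType.
Implicit Types (f : nat -> F) (p q w : {poly F}) (m n : nat).

(** The polynomial x |-> x choose j. *)
Definition binomial_poly (j : nat) : {poly F} :=
  (j`!%:R)^-1 *: \prod_(i < j) ('X - i%:R%:P).

Definition newton_poly m f : {poly F} :=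
  \sum_(j < m) iter j (@fdiff F) f 0 *: binomial_poly j.

Lemma size_binomial_poly j : size (binomial_poly j) = j.+1.
Proof.
rewrite size_scale ?invr_eq0 ?pnatr_eq0 -?lt0n ?fact_gt0//.
rewrite -(big_mkord xpredT (fun i => 'X - i%:R%:P)).
by rewrite size_prod_XsubC size_iota subn0.
Qed.

Lemma horner_binomial_poly j n : (binomial_poly j).[n%:R] = 'C(n, j)%:R.
Proof.
have fj : (j`!)%:R != 0 :> F by rewrite pnatr_eq0 -lt0n fact_gt0.
rewrite hornerZ; apply: (mulfI fj); rewrite mulVKf// -natrM mulnC bin_ffact.
elim: {fj}j => [|j IHj]; first by rewrite big_ord0 hornerC ffactn0.
rewrite big_ord_recr hornerM IHj hornerXsubC ffactnSr natrM.
have [jn|nj] := leqP j n; first by rewrite natrB.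
by rewrite ffact_small// !mul0r.
Qed.

Lemma size_newton_poly m f : (size (newton_poly m f) <= m)%N.
Proof.
apply: (leq_trans (size_sum _ _ _)); apply/bigmax_leqP => j _.
by apply: (leq_trans (size_scale_leq _ _)); rewrite size_binomial_poly.
Qed.

Lemma horner_newton_poly m f n : (newton_poly m f).[n%:R] =
  \sum_(j < m) iter j (@fdiff F) f 0 * 'C(n, j)%:R.
Proof.
rewrite horner_sum; apply: eq_bigr => j _.
by rewrite hornerZ horner_binomial_poly.
Qed.

Lemma newton_poly_interpolates m f n : (n < m)%N ->
  (newton_poly m f).[n%:R] = f n.
Proof. by move=> nm; rewrite horner_newton_poly -newton_forward. Qed.

Lemma poly_nat_inj m p q : (size p <= m)%N -> (size q <= m)%N ->
  (forall n, (n < m)%N -> p.[n%:R] = q.[n%:R]) -> p = q.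
Proof.
move=> pm qm pq; apply/eqP; rewrite -subr_eq0; apply: contraT => pq0.
have pqm : (size (p - q)%R <= m)%N.
  by rewrite (leq_trans (size_polyD _ _))// size_polyN geq_max pm.
have := max_poly_roots pq0 (rs := [seq i%:R | i <- iota 0 m]).
rewrite size_map size_iota ltnNge pqm; apply.
  apply/allP => _ /mapP[i + ->]; rewrite mem_iota/= => im.
  by rewrite /root hornerD hornerN pq// subrr.
by rewrite map_inj_uniq ?iota_uniq//; exact: mulrIn (oner_neq0 F).
Qed.

(** A polynomial with at most m coefficients is the Newton polynomial of its
own first m values, hence a combination of binomials of order less than m. *)
Lemma poly_iter_fdiff_eq0 m p n : (size p <= m)%N ->
  iter m (@fdiff F) (fun k => p.[k%:R]) n = 0.
Proof.
move=> pm; have [f ->] : exists f, p = newton_poly m f.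
  exists (fun k => p.[k%:R]); apply: (@poly_nat_inj m) => // [|i im].
    exact: size_newton_poly.
  by rewrite newton_poly_interpolates.
under eq_iter_fdiff => k do rewrite horner_newton_poly.
rewrite iter_fdiff_sum big1// => j _.
by rewrite iter_fdiffZ iter_fdiff_bin// mulr0.
Qed.

End NewtonPolynomials.

(** * Polynomials positive on the natural numbers *)

Section PositivePolynomials.
Variable R : realType.
Implicit Types (w : {poly R}).

(** Otherwise -w would have positive leading coefficient, and would be
positive at every large natural number. *)
Lemma lead_coef_gt0_of_nat w :
  (forall n : nat, 0 < w.[n%:R]) -> 0 < lead_coef w.
Proof.
move=> w_gt0; have [//|lw|lw0] := ltgtP 0 (lead_coef w); last first.
  have /eqP w0 : w == 0 by rewrite -lead_coef_eq0 -lw0.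
  by have := w_gt0 0%N; rewrite w0 horner0 ltxx.
have [|x /(_ (Num.truncn x).+1%:R)] := @poly_pinfty_gt_lc R (- w).
  by rewrite lead_coefN oppr_gt0.
rewrite lead_coefN hornerN => H.
have /H : x <= (Num.truncn x).+1%:R.
  exact: ltW (truncnS_gt x).
by have := w_gt0 (Num.truncn x).+1; lra.
Qed.

(** This bounds the weights of the shift built from w. The ratio tends to 1:
2 w(x) - w(x+1) has the leading coefficient of w, so it is positive from some
point on; the finitely many earlier ratios are added to the bound. *)
Lemma ratio_bounded w : (forall n : nat, 0 < w.[n%:R]) ->
  exists2 M : R, 0 < M & forall n : nat, w.[n.+1%:R] <= M * w.[n%:R].
Proof.
move=> w_gt0; have lw := lead_coef_gt0_of_nat w_gt0.
pose q := 2%:R *: w - (w \Po ('X + 1%:P)).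
have hq (n : nat) : q.[n%:R] = 2%:R * w.[n%:R] - w.[n.+1%:R].
  rewrite /q hornerD hornerN hornerZ horner_comp.
  by rewrite hornerD hornerX hornerC natr1.
have sX : size ('X + 1%:P : {poly R}) = 2%N by rewrite size_XaddC.
have lXw : lead_coef (w \Po ('X + 1%:P)) = lead_coef w.
  by rewrite lead_coef_comp ?sX// lead_coefXaddC expr1n mulr1.
have lq : 0 < lead_coef q.
  (* Translation keeps the size and the leading coefficient. *)
  have cq : q`_(size w).-1 = lead_coef w.
    rewrite coefB coefZ.
    rewrite -[(size w).-1 in X in _ - X](f_equal predn (size_comp_poly2 w sX)).
    by rewrite -!lead_coefE lXw; ring.
  rewrite [lead_coef q](_ : _ = lead_coef w)// -cq lead_coefE.
  have qw : (size q <= size w)%N.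
    apply: (leq_trans (size_polyD _ _)); rewrite size_polyN size_comp_poly2//.
    by rewrite geq_max leqnn andbT size_scale_leq.
  congr (q`_ _.-1); apply/eqP; rewrite eqn_leq qw/=.
  rewrite -[X in (X <= _)%N]prednK ?size_poly_gt0 -?lead_coef_eq0 ?gt_eqF//.
  rewrite ltnNge; apply/negP => /leq_sizeP /(_ _ (leqnn _)).
  by rewrite cq => lw0; rewrite lw0 ltxx in lw.
have [x xq] := poly_pinfty_gt_lc lq.
(* 2 serves beyond the threshold, the sum of the ratios serves before it. *)
pose r (n : nat) := w.[n.+1%:R] / w.[n%:R].
have r_ge0 n : 0 <= r n by rewrite divr_ge0// ltW.
pose N := (Num.truncn x).+1; exists (2%:R + \sum_(i < N) r i) => [|n].
  by rewrite ltr_wpDr// sumr_ge0.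
have [nN|Nn] := ltnP n N.
  rewrite -ler_pdivrMr// -/(r n) (bigD1 (Ordinal nN))//= addrCA lerDl.
  by rewrite addr_ge0// sumr_ge0.
apply: (@le_trans _ _ (2%:R * w.[n%:R])); last first.
  by rewrite ler_wpM2r ?(ltW (w_gt0 n))// lerDl sumr_ge0.
rewrite -subr_ge0 -hq (le_trans (ltW lq))// xq//.
rewrite (@le_trans _ _ N%:R) ?ler_nat//.
exact: ltW (truncnS_gt x).
Qed.

End PositivePolynomials.

(** * Norms and coordinates in the space of square-summable sequences *)

Section SquareSummableSequences.
Variable R : realType.
Local Open Scope complex_scope.
Local Open Scope classical_set_scope.
Implicit Types (x y : ell2 R) (T : {linear ell2 R -> ell2 R}).

Definition ell2_sqnorm x : R := limn (series (fun n => Normc.normc (x n) ^+ 2)).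

Lemma partial_sqnorm_le x N :
  \sum_(0 <= i < N) Normc.normc (x i) ^+ 2 <= ell2_sqnorm x.
Proof.
have /asboolP cx := ell2P x.
apply: (nondecreasing_cvgn_le _ cx N).
by apply: nondecreasing_series => j _ _; exact: sqr_ge0.
Qed.

Lemma ell2_sqnorm_ge0 x : 0 <= ell2_sqnorm x.
Proof. by have := partial_sqnorm_le x 0; rewrite big_geq. Qed.

(** Provides the membership proofs for the images of the two shifts. *)
Lemma square_summable_bounded (u : nat -> R[i]) (B : R) :
  (forall N, \sum_(0 <= i < N) Normc.normc (u i) ^+ 2 <= B) ->
  u \in @square_summable R.
Proof.
move=> uB; apply/asboolP; apply: nondecreasing_is_cvgn.
  by apply: nondecreasing_series => j _ _; exact: sqr_ge0.
by exists B => _ [N _ <-]; exact: uB.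
Qed.

Lemma ell2_sqnorm_le x (B : R) :
  (forall N, \sum_(0 <= i < N) Normc.normc (x i) ^+ 2 <= B) ->
  ell2_sqnorm x <= B.
Proof.
move=> xB; have /asboolP cx := ell2P x.
by apply: limr_le => //; apply: nearW => N; exact: xB.
Qed.

(** Reduces boundedness of an operator, where norms are complex square roots,
to an inequality between real numbers. *)
Lemma bounded_op_sqnorm T (M : R) : 0 <= M ->
  (forall x, ell2_sqnorm (T x) <= M * ell2_sqnorm x) ->
  bounded_op (@ell2_dot R) T.
Proof.
move=> M0 TM; exists (sqrtC M%:C) => x; rewrite /= !ell2_dotE.
have sq0 y : 0 <= (ell2_sqnorm y)%:C by rewrite lecR ell2_sqnorm_ge0.
rewrite -rootCMl ?lecR// ler_sqrtC ?nnegrE ?sq0//.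
  by rewrite -rmorphM lecR; exact: TM.
by apply: mulr_ge0 (sq0 x); rewrite lecR.
Qed.

Lemma ell2_dot_basis x n : ell2_dot x (ell2_basis R n) = x n.
Proof.
apply: (@cvg_lim R[i]^o); first exact: norm_hausdorff.
apply: cvg_near_cst; exists n.+1 => // N /= nN.
rewrite /series/= big_mkord (bigD1 (Ordinal nN))//= eqxx conjC1 mulr1.
rewrite big1 ?addr0// => i; rewrite -val_eqE/= => /negbTE ->.
by rewrite conjC0 mulr0.
Qed.

Lemma ell2_sumE (I : Type) (r : seq I) (v : I -> ell2 R) n :
  (\sum_(i <- r) v i : ell2 R) n = \sum_(i <- r) v i n.
Proof. by apply: (big_morph (fun z : ell2 R => z n)). Qed.

End SquareSummableSequences.

(** * The forward shift with bounded real weights and its adjoint *)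

Section BoundedShift.
Variable R : realType.
Local Open Scope complex_scope.
Local Open Scope classical_set_scope.
Variables (lam : nat -> R) (M : R).
Hypothesis lamM : forall n, lam n ^+ 2 <= M.
Implicit Types (x y : ell2 R).

Let M_ge0 : 0 <= M.
Proof. exact: le_trans (sqr_ge0 _) (lamM 0%N). Qed.

Let normc_scale_sqr n (z : R[i]) :
  Normc.normc ((lam n)%:C * z) ^+ 2 <= M * Normc.normc z ^+ 2.
Proof.
rewrite Normc.normcM exprMn ler_wpM2r ?sqr_ge0//.
by rewrite normc_sqr/= expr0n addr0.
Qed.

Definition forward_seq (u : nat -> R[i]) n : R[i] :=
  if n is n'.+1 then (lam n')%:C * u n' else 0.

Definition backward_seq (u : nat -> R[i]) n : R[i] := (lam n)%:C * u n.+1.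

Let forward_partial x N :
  \sum_(0 <= i < N) Normc.normc (forward_seq x i) ^+ 2 <= M * ell2_sqnorm x.
Proof.
case: N => [|N].
  by rewrite big_geq// mulr_ge0// ell2_sqnorm_ge0.
rewrite big_nat_recl// normc_sqr/= expr0n addr0 add0r.
apply: (le_trans (ler_sum _ (fun i _ => normc_scale_sqr i (x i)))).
by rewrite -mulr_sumr ler_wpM2l// partial_sqnorm_le.
Qed.

Let backward_partial x N :
  \sum_(0 <= i < N) Normc.normc (backward_seq x i) ^+ 2 <= M * ell2_sqnorm x.
Proof.
apply: (le_trans (ler_sum _ (fun i _ => normc_scale_sqr i (x i.+1)))).
rewrite -mulr_sumr ler_wpM2l//.
apply: le_trans (partial_sqnorm_le x N.+1).
by rewrite [leRHS]big_nat_recl// lerDr sqr_ge0.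
Qed.

Definition forward_shift x : ell2 R :=
  Ell2 (square_summable_bounded (forward_partial x)).

Definition backward_shift x : ell2 R :=
  Ell2 (square_summable_bounded (backward_partial x)).

Let forward_shift_linear : linear forward_shift.
Proof.
move=> a x y; apply/val_inj/funext => -[|n].
  by change (0 = a * 0 + 0 :> R[i]); rewrite mulr0 addr0.
change ((lam n)%:C * (a * x n + y n) =
        a * ((lam n)%:C * x n) + (lam n)%:C * y n).
by rewrite mulrDr mulrCA.
Qed.

HB.instance Definition _ := GRing.isLinear.Build R[i] (ell2 R) (ell2 R) _
  forward_shift forward_shift_linear.

Let backward_shift_linear : linear backward_shift.
Proof.
move=> a x y; apply/val_inj/funext => n.
change ((lam n)%:C * (a * x n.+1 + y n.+1) =
        a * ((lam n)%:C * x n.+1) + (lam n)%:C * y n.+1).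
by rewrite mulrDr mulrCA.
Qed.

HB.instance Definition _ := GRing.isLinear.Build R[i] (ell2 R) (ell2 R) _
  backward_shift backward_shift_linear.

Lemma forward_shift_bounded :
  bounded_op (@ell2_dot R) forward_shift.
Proof.
apply: (bounded_op_sqnorm M_ge0) => x.
by apply: ell2_sqnorm_le => N; exact: forward_partial.
Qed.

Lemma backward_shift_bounded :
  bounded_op (@ell2_dot R) backward_shift.
Proof.
apply: (bounded_op_sqnorm M_ge0) => x.
by apply: ell2_sqnorm_le => N; exact: backward_partial.
Qed.

(** The two scalar products have the same partial sums, up to a shift of the
summation index by one: the first term on the left vanishes. *)
Lemma shift_adjoint :
  adjoint_op (@ell2_dot R) forward_shift backward_shift.
Proof.
move=> x y; apply: (@cvg_lim R[i]^o); first exact: norm_hausdorff.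
rewrite -cvg_shiftS/=; set u := (X in X @ _ --> _).
rewrite (_ : u = series (fun n => x n * (backward_shift y n)^*%R : R[i]^o)).
  exact: is_cvg_ell2_dot.
apply/funext => N; rewrite /u /series/= big_nat_recl//= mul0r add0r.
apply: eq_bigr => i _; rewrite /backward_seq rmorphM/= mulrA (mulrC (x i)).
congr (_ * _ * _); exact: esym (conjc_real _).
Qed.

End BoundedShift.

(** * Shifts that are m-isometries *)

Section ShiftMoments.
Variable R : realType.
Local Open Scope complex_scope.
Local Open Scope classical_set_scope.
Implicit Types (x y : ell2 R) (S T : {linear ell2 R -> ell2 R}).

(** The squared norm of the n-th iterate of the shift at the first basis vector.
For a finite sequence s, [beta s] is the moment of [nth 0 s]. *)
Definition moment (lam : nat -> R) n : R := \prod_(i < n) lam i ^+ 2.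

Lemma momentS lam n : moment lam n.+1 = moment lam n * lam n ^+ 2.
Proof. by rewrite /moment big_ord_recr. Qed.

Lemma moment_gt0 lam n : (forall i, 0 < lam i) -> 0 < moment lam n.
Proof. by move=> lam_gt0; apply: prodr_gt0 => i _; rewrite exprn_gt0. Qed.

Lemma momentD lam n j :
  moment lam (n + j) = moment lam n * \prod_(i < j) lam (n + i)%N ^+ 2.
Proof.
elim: j => [|j IHj]; first by rewrite addn0 big_ord0 mulr1.
by rewrite addnS momentS IHj big_ord_recr/= mulrA.
Qed.

Variables (lam : nat -> R) (S T : {linear ell2 R -> ell2 R}).
Hypothesis lam_gt0 : forall n, 0 < lam n.
Hypothesis S_basis :
  forall n, S (ell2_basis R n) = (lam n)%:C *: ell2_basis R n.+1.
Hypothesis ST : adjoint_op (@ell2_dot R) S T.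

(** The coordinates of T y are its scalar products with the basis, which S maps
to multiples of the basis. This determines T on all vectors, and S in turn as
the adjoint of T ([shift_coord]). *)
Lemma adjoint_shift_coord y n : T y n = (lam n)%:C * y n.+1.
Proof.
rewrite -[LHS]ell2_dot_basis ell2_dotC -ST S_basis -ell2_dotC.
rewrite [LHS]linearZr/= ell2_dot_basis; congr (_ * _).
exact: conjc_real.
Qed.

Lemma shift_coord x n : S x n.+1 = (lam n)%:C * x n.
Proof.
rewrite -[LHS]ell2_dot_basis ST.
have -> : T (ell2_basis R n.+1) = (lam n)%:C *: ell2_basis R n.
  apply/val_inj/funext => i; rewrite [LHS]adjoint_shift_coord.
  change ((lam i)%:C * (i.+1 == n.+1)%:R = (lam n)%:C * (i == n)%:R :> R[i]).
  by rewrite eqSS; have [->|_] := eqVneq i n; rewrite ?mulr0.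
rewrite [LHS]linearZr/= ell2_dot_basis; congr (_ * _).
exact: conjc_real.
Qed.

Lemma iter_shift_coord j x n :
  iter j S x (n + j)%N = (\prod_(i < j) lam (n + i)%N)%:C * x n.
Proof.
elim: j => [|j IHj]; first by rewrite addn0 big_ord0 mul1r.
rewrite iterS addnS shift_coord IHj big_ord_recr/= mulrA -rmorphM.
by rewrite [lam _ * _]mulrC.
Qed.

Lemma iter_adjoint_shift_coord j y n :
  iter j T y n = (\prod_(i < j) lam (n + i)%N)%:C * y (n + j)%N.
Proof.
elim: j n => [|j IHj] n; first by rewrite addn0 big_ord0 mul1r.
rewrite iterS adjoint_shift_coord IHj mulrA -rmorphM big_ord_recl.
rewrite addn0 addnS -addSn; congr ((_ * _)%:C * _).
by apply: eq_bigr => i _; rewrite lift0 addnS.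
Qed.

Lemma iter_adjoint_iter_shift_coord j x n :
  iter j T (iter j S x) n = (moment lam (n + j) / moment lam n)%:C * x n.
Proof.
rewrite iter_adjoint_shift_coord iter_shift_coord mulrA -rmorphM.
rewrite momentD mulrAC divff ?gt_eqF ?moment_gt0// mul1r -big_split/=.
by under eq_bigr do rewrite -expr2.
Qed.

(** The operator defining m-isometries is diagonal, with entries proportional
to the m-th difference of the moments. *)
Lemma m_isometry_sum_coord m x n :
  (\sum_(j < m.+1) ((-1) ^+ j * 'C(m, j)%:R) *: iter j T (iter j S x) : ell2 R)
    n = ((-1) ^+ m * iter m (@fdiff R) (moment lam) n / moment lam n)%:C * x n.
Proof.
rewrite ell2_sumE -alternating_sum_fdiff mulr_suml rmorph_sum mulr_suml.
apply: eq_bigr => j _.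
transitivity ((-1) ^+ j * 'C(m, j)%:R * iter j T (iter j S x) n) => //.
rewrite iter_adjoint_iter_shift_coord mulrA -(mulrA _ (moment _ _)).
have -> : (-1) ^+ j * 'C(m, j)%:R = ((-1) ^+ j * 'C(m, j)%:R : R)%:C.
  by rewrite [RHS]rmorphM/= rmorph_sign rmorph_nat.
by rewrite -rmorphM.
Qed.

Lemma m_isometry_sum_eq0 m :
  (forall x, \sum_(j < m.+1)
     ((-1) ^+ j * 'C(m, j)%:R) *: iter j T (iter j S x) = 0) <->
  (forall n, iter m (@fdiff R) (moment lam) n = 0).
Proof.
split=> [sum0 n|diff0 x]; last first.
  apply/val_inj/funext => n; rewrite [LHS]m_isometry_sum_coord.
  by rewrite diff0 mulr0 !mul0r.
have := m_isometry_sum_coord m (ell2_basis R n) n; rewrite sum0.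
rewrite [in RHS]/= eqxx mulr1 => /esym/(congr1 (@complex.Re R))/=/eqP.
rewrite !mulf_eq0 invr_eq0 [X in _ || X]gt_eqF ?moment_gt0// orbF.
by rewrite signr_eq0/= => /eqP.
Qed.

End ShiftMoments.

(** * Moments of an m-isometric shift are polynomial *)

Section IsometricShifts.
Variable R : realType.
Local Open Scope complex_scope.
Implicit Types (S T : {linear ell2 R -> ell2 R}) (w : {poly R}).

Section PositiveShift.
Variables (lam : nat -> R) (S : {linear ell2 R -> ell2 R}).
Hypothesis lam_gt0 : forall n, 0 < lam n.
Hypothesis S_basis :
  forall n, S (ell2_basis R n) = (lam n)%:C *: ell2_basis R n.+1.

Lemma m_isometry_fdiff_moment m n : m_isometry (@ell2_dot R) m S ->
  iter m (@fdiff R) (moment lam) n = 0.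
Proof.
by move=> [_ [T [_ ST /(m_isometry_sum_eq0 lam_gt0 S_basis ST)]]]; exact.
Qed.

Lemma fdiff_moment_m_isometry m p : m_isometry (@ell2_dot R) m S ->
  (forall n, iter p (@fdiff R) (moment lam) n = 0) ->
  m_isometry (@ell2_dot R) p S.
Proof.
move=> [Sb [T [Tb ST _]]] p0; split => //; exists T; split=> //.
exact/(m_isometry_sum_eq0 lam_gt0 S_basis ST).
Qed.

(** The moments and w agree at the first m natural numbers, and both have zero
m-th difference. *)
Lemma m_isometry_moment_poly m w :
  m_isometry (@ell2_dot R) m S -> interpolates m (moment lam) w ->
  forall n, moment lam n = w.[n%:R].
Proof.
move=> Sm [wm wE] n.
apply: (@iter_fdiff_inj R m n _ (fun k => w.[k%:R])) => // [i im|i _].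
  by rewrite wE.
by rewrite m_isometry_fdiff_moment// poly_iter_fdiff_eq0.
Qed.

(** For m >= 2, being an (m-1)-isometry means that the moments are given by a
polynomial with fewer than m coefficients, which by uniqueness of interpolation
is w. For m = 1 strictness asks for an isometry, which a 1-isometry is, and w
is the constant 1. *)
Lemma strict_m_isometry_size m w : (0 < m)%N ->
  m_isometry (@ell2_dot R) m S -> interpolates m (moment lam) w ->
  (strict_m_isometry (@ell2_dot R) m S <-> size w = m).
Proof.
move=> m0 Sm wm; have mw := m_isometry_moment_poly Sm wm.
case: wm => wm wE; case: m m0 Sm wm wE => [//|[|m]] _ Sm wm wE.
  split=> [_|_].
    apply/eqP; rewrite eqn_leq wm lt0n size_poly_eq0; apply/eqP => w0.
    have := mw 0%N; rewrite w0 horner0 /moment big_ord0 => /eqP.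
    by rewrite oner_eq0.
  split=> //; left; split=> // x y.
  case: Sm => _ [T [_ ST TS]]; transitivity (ell2_dot x (T (S y))).
    exact: ST.
  congr (ell2_dot x _); apply/esym.
  have := TS y; rewrite !big_ord_recl big_ord0 /= addr0 !bin0 binn.
  by rewrite expr0 expr1 !mulr1 scale1r scaleN1r => /subr0_eq.
split=> [[_ [[]//|[_ nS]]]|sw]; last first.
  split=> //; right; split=> // Sm1.
  have wN : w = newton_poly m.+1 (moment lam).
    apply: (@poly_nat_inj R m.+2) => // [|n _].
      by rewrite (leq_trans (size_newton_poly _ _)).
    rewrite -mw; apply: (m_isometry_moment_poly Sm1).
    split=> [|i im]; first exact: size_newton_poly.
    exact: newton_poly_interpolates.
  by have := size_newton_poly m.+1 (moment lam); rewrite -wN sw ltnn.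
apply/eqP; rewrite eqn_leq wm ltnNge; apply/negP => wm1; apply: nS.
apply: (fdiff_moment_m_isometry Sm) => n.
rewrite (@eq_iter_fdiff _ _ _ (fun k => w.[k%:R]))//.
exact: poly_iter_fdiff_eq0.
Qed.

End PositiveShift.

(** The squared weights are the ratios of consecutive values of w, so that the
moments telescope to w, as w(0) = 1. *)
Lemma shift_of_poly m w : (size w <= m)%N -> w.[0] = 1 ->
  (forall n : nat, 0 < w.[n%:R]) ->
  let lam n := Num.sqrt (w.[n.+1%:R] / w.[n%:R]) in
  exists S, unilateral_weighted_shift (fun n => (lam n)%:C) S /\
    m_isometry (@ell2_dot R) m S.
Proof.
move=> wm w0 w_gt0 lam; have [M M0 wM] := ratio_bounded w_gt0.
have lam_gt0 n : 0 < lam n by rewrite sqrtr_gt0 divr_gt0.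
have lam2 n : lam n ^+ 2 = w.[n.+1%:R] / w.[n%:R].
  by rewrite sqr_sqrtr// divr_ge0// ltW.
have lamM n : lam n ^+ 2 <= M by rewrite lam2 ler_pdivrMr.
have momentE n : moment lam n = w.[n%:R].
  elim: n => [|n IHn]; first by rewrite /moment big_ord0 w0.
  by rewrite momentS IHn lam2 mulrC divfK// gt_eqF.
have S_basis n : forward_shift lamM (ell2_basis R n) =
    (lam n)%:C *: ell2_basis R n.+1.
  apply/val_inj/funext => -[|i].
    by change (0 = (lam n)%:C * 0 :> R[i]); rewrite mulr0.
  change ((lam i)%:C * (i == n)%:R = (lam n)%:C * (i.+1 == n.+1)%:R :> R[i]).
  by rewrite eqSS; have [->|_] := eqVneq i n; rewrite ?mulr0.
exists (forward_shift lamM); split.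
  split=> //; first exact: forward_shift_bounded.
  - by move=> n; apply/eqP => -[/eqP]; rewrite gt_eqF.
  - exists (Num.sqrt M)%:C => n; rewrite normc_def/= expr0n addr0 lecR.
    exact: ler_wsqrtr.
split; first exact: forward_shift_bounded.
exists (backward_shift lamM); split.
- exact: backward_shift_bounded.
- exact: shift_adjoint.
- apply/(m_isometry_sum_eq0 lam_gt0 S_basis (shift_adjoint lamM)) => n.
  rewrite (@eq_iter_fdiff _ _ _ (fun k => w.[k%:R]))//.
  exact: poly_iter_fdiff_eq0.
Qed.

End IsometricShifts.

(** * Completions of finite sequences *)

Section Completions.
Variable R : realType.
Local Open Scope complex_scope.
Implicit Types (S : {linear ell2 R -> ell2 R}) (w : {poly R}) (s : seq R).

Lemma betaS s n : beta s n.+1 = beta s n * s`_n ^+ 2.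
Proof. exact: momentS. Qed.

Lemma beta_gt0 s n : (forall x, x \in s -> 0 < x) -> (n <= size s)%N ->
  0 < beta s n.
Proof.
move=> s_gt0 ns; apply: prodr_gt0 => i _; rewrite exprn_gt0// s_gt0//.
by rewrite mem_nth// (leq_trans _ ns).
Qed.

Lemma interpolates_unique m (b : nat -> R) w : interpolates m b w ->
  unique (interpolates m b) w.
Proof.
move=> wb; split=> // w' [w'm w'b]; case: wb => wm wb.
by apply: (poly_nat_inj wm w'm) => n nm; rewrite wb// w'b.
Qed.

Lemma interpolates_newton_poly m (b : nat -> R) :
  interpolates m b (newton_poly m b).
Proof.
by split=> [|n]; [exact: size_newton_poly|exact: newton_poly_interpolates].
Qed.

Lemma moment_beta s (lam : nat -> R) n :
  (forall i, (i < size s)%N -> lam i = s`_i) -> (n <= size s)%N ->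
  moment lam n = beta s n.
Proof.
by move=> lams ns; apply: eq_bigr => i _; rewrite lams// (leq_trans _ ns).
Qed.

Variables (m : nat) (s : seq R) (w : {poly R}).
Hypothesis m_gt0 : (0 < m)%N.
Hypothesis s_gt0 : forall x, x \in s -> 0 < x.
Hypothesis ms : (m <= (size s).+1)%N.
Hypothesis wb : interpolates m (beta s) w.

Let interpolates_moment (lam : nat -> R) :
  (forall i, (i < size s)%N -> lam i = s`_i) ->
  interpolates m (moment lam) w.
Proof.
move=> lams; case: wb => wm wE; split=> // n nm.
by rewrite wE// (moment_beta lams)// -ltnS (leq_trans nm).
Qed.

(** The moments of a completion are the values of w and extend [beta s], which
gives both conditions. Conversely, the difference equations say exactly that w
takes the values [beta s n] up to n = [size s], not only for n < m; hence the
weights built from w extend s. *)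
Lemma completion_iff :
  (exists S, m_isometric_completion m s S) <->
  (forall n : nat, (n + m <= size s)%N ->
     \sum_(j < m.+1) (-1) ^+ j * 'C(m, j)%:R * beta s (n + j) = 0) /\
  (forall n : nat, (m <= n)%N -> 0 < w.[n%:R]).
Proof.
split=> [[S [[lam [lam_gt0 lams [_ _ _ S_basis]]] Sm]]|[beta0 w_gt0]].
  have := interpolates_moment lams => wlam.
  split=> [n nms|n _]; last first.
    by rewrite -(m_isometry_moment_poly lam_gt0 S_basis Sm wlam) moment_gt0.
  transitivity (\sum_(j < m.+1) (-1) ^+ j * 'C(m, j)%:R * moment lam (n + j)).
    apply: eq_bigr => j _; rewrite (moment_beta lams)// (leq_trans _ nms)//.
    by rewrite leq_add2l -ltnS.
  rewrite alternating_sum_fdiff.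
  by rewrite (m_isometry_fdiff_moment lam_gt0 S_basis n Sm) mulr0.
case: wb => wm wE.
have bw n : (n <= size s)%N -> beta s n = w.[n%:R].
  move: n; apply: (@iter_fdiff_inj R m _ _ (fun k => w.[k%:R])) => [n nm|n nms].
    by rewrite wE.
  rewrite poly_iter_fdiff_eq0//; apply/eqP; have := beta0 n nms.
  by rewrite alternating_sum_fdiff => /eqP; rewrite mulf_eq0 signr_eq0.
have {}w_gt0 n : 0 < w.[n%:R].
  have [nm|/w_gt0//] := ltnP n m; rewrite wE// beta_gt0//.
  by rewrite -ltnS (leq_trans nm).
have w0 : w.[0] = 1 by rewrite -[0]/(0%:R) -bw// /beta big_ord0.
have [S [Ssh Sm]] := shift_of_poly wm w0 w_gt0.
exists S; split=> //; exists (fun n => Num.sqrt (w.[n.+1%:R] / w.[n%:R])).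
split=> // n; first by rewrite sqrtr_gt0 divr_gt0.
move=> ns; rewrite -!bw// ?(ltnW ns)// betaS mulrAC divff ?mul1r.
  by rewrite sqrtr_sqr ger0_norm// ltW// s_gt0// mem_nth.
by rewrite gt_eqF// beta_gt0// ltnW.
Qed.

Lemma strict_completion_iff S : m_isometric_completion m s S ->
  (strict_m_isometric_completion m s S <-> size w = m).
Proof.
move=> [Ss Sm]; have [lam [lam_gt0 lams [_ _ _ S_basis]]] := Ss.
have H := strict_m_isometry_size lam_gt0 S_basis m_gt0 Sm
  (interpolates_moment lams).
by split=> [[_ /H//]|/H].
Qed.

End Completions.

(** * Completions of sequences with a large last weight *)

Section LargeLastDifference.
Variable R : realFieldType.

(** A crude form of the fact that, beyond p, the largest order dominates: each
step uses (p+1) 'C(n, p+1) = (n-p) 'C(n, p) with n - p >= 1. *)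
Lemma leq_bin_fact n p j : (j <= p)%N -> (p <= n)%N ->
  ('C(n, j) <= p`! * 'C(n, p))%N.
Proof.
elim: p => [|p IHp].
  by rewrite leqn0 => /eqP-> _; rewrite mul1n.
rewrite leq_eqVlt => /predU1P[-> _|]; first by rewrite leq_pmull ?fact_gt0.
rewrite ltnS => jp pn; apply: (leq_trans (IHp jp (ltnW pn))).
rewrite factS -mulnA mulnCA leq_pmul2l ?fact_gt0// mul_bin_left.
by rewrite leq_pmull// subn_gt0.
Qed.

(** The lower terms of the Newton polynomial are bounded by A times the binomial
of order p, so any larger coefficient of the latter makes the sum positive. *)
Lemma newton_poly_add_gt0 (b : nat -> R) p : exists A : R, 0 <= A /\
  forall (a : R) n, A < a -> (p <= n)%N ->
    0 < (newton_poly p b + a *: binomial_poly R p).[n%:R].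
Proof.
pose d j := iter j (@fdiff R) b 0.
exists (\sum_(j < p) `|d j| * p`!%:R); split=> [|a n Aa pn].
  by apply: sumr_ge0 => j _; rewrite mulr_ge0.
rewrite hornerD hornerZ horner_newton_poly horner_binomial_poly.
have Cp : 0 < 'C(n, p)%:R :> R by rewrite ltr0n bin_gt0.
rewrite -ltrBlDl sub0r.
apply: le_lt_trans (_ : _ <= _ * 'C(n, p)%:R) _; last first.
  by rewrite ltr_pM2r//; exact: Aa.
rewrite mulr_suml -sumrN; apply: ler_sum => j _.
apply: le_trans (ler_norm _) _; rewrite normrN normrM -mulrA ler_wpM2l//.
by rewrite normr_nat -natrM ler_nat leq_bin_fact// ltnW.
Qed.

End LargeLastDifference.

Section BetaConcatenation.
Variable R : realType.
Implicit Types s : seq R.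

Lemma beta_rcons s r n : (n <= size s)%N -> beta (rcons s r) n = beta s n.
Proof.
move=> ns; apply: eq_bigr => i _.
by rewrite nth_rcons (leq_trans (ltn_ord i) ns).
Qed.

Lemma beta_rcons_size s r :
  beta (rcons s r) (size s).+1 = beta s (size s) * r ^+ 2.
Proof. by rewrite betaS beta_rcons// nth_rcons ltnn eqxx. Qed.

(** The last weight r enters only the last coefficient a of the Newton form. *)
Lemma exists_strict_completion_rcons s : (forall x, x \in s -> 0 < x) ->
  exists c : R, 0 < c /\ forall r, c <= r ->
    exists S, strict_m_isometric_completion (size s).+2 (rcons s r) S.
Proof.
move=> s_gt0; set p := (size s).+1.
pose v := newton_poly p (beta s); pose B := beta s (size s).
have B_gt0 : 0 < B by exact: beta_gt0.
have [A [A0 HA]] := newton_poly_add_gt0 (beta s) p.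
pose K := A + `|v.[p%:R]| + 1.
have K_gt0 : 0 < K by rewrite ltr_wpDl// addr_ge0.
have KB : 0 < K / B by rewrite divr_gt0.
(* With c = 1 + K/B one has r >= 1, so B r^2 >= B r >= K, and K exceeds the
   threshold A plus the value that is subtracted from B r^2. *)
exists (1 + K / B); split=> [|r cr]; first by rewrite addr_gt0.
have r_gt0 : 0 < r by apply: lt_le_trans cr; rewrite addr_gt0.
pose a := B * r ^+ 2 - v.[p%:R].
have Aa : A < a.
  have KBr : K <= B * r ^+ 2.
    rewrite -ler_pdivrMl// mulrC; apply: (@le_trans _ _ r).
      by apply: le_trans cr; rewrite lerDr.
    by rewrite ler_eXnr// (le_trans _ cr)// lerDl ltW.
  by have := ler_norm v.[p%:R]; rewrite /a; move: KBr; rewrite /K; lra.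
pose w := v + a *: binomial_poly R p.
have rs_gt0 x : x \in rcons s r -> 0 < x.
  by rewrite mem_rcons inE => /predU1P[->//|/s_gt0].
have sw : size w = p.+1.
  have sa : size (a *: binomial_poly R p) = p.+1.
    by rewrite size_scale ?size_binomial_poly// gt_eqF// (le_lt_trans A0).
  by rewrite /w addrC size_polyDl sa// ltnS size_newton_poly.
have wb : interpolates p.+1 (beta (rcons s r)) w.
  split=> [|n]; first by rewrite sw.
  rewrite hornerD hornerZ horner_binomial_poly ltnS leq_eqVlt.
  move=> /predU1P[->|np]; last first.
    by rewrite bin_small// mulr0 addr0 newton_poly_interpolates// beta_rcons.
  by rewrite binn mulr1 beta_rcons_size addrC subrK.
have ps : (p.+1 <= (size (rcons s r)).+1)%N by rewrite size_rcons.
have [_ completable] := completion_iff rs_gt0 ps wb.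
have [|S Sc] := completable; last first.
  by exists S; apply/(strict_completion_iff (ltn0Sn p) ps wb Sc).
split=> n; last by move=> /ltnW; exact: HA.
by rewrite size_rcons => /(leq_trans (leq_addl _ _)); rewrite ltnn.
Qed.

End BetaConcatenation.

Theorem proposition3p2 (R : realType) (m k : nat) (lam : k.-tuple R)
    (m_gt0 : (0 < m)%N) (k_gt0 : (0 < k)%N)
    (lam_gt0 : forall x : R, x \in lam -> 0 < x) :
  ((k + 2 <= m)%N ->
   forall mu : (m - 2 - k).-tuple R, (forall x : R, x \in mu -> 0 < x) ->
   exists c : R, 0 < c /\
     forall r : R, c <= r ->
       exists S : {linear ell2 R -> ell2 R},
         strict_m_isometric_completion m (rcons (lam ++ mu) r) S)
  /\
  ((m < k + 2)%N ->
   exists w : {poly R},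
     [/\ unique (interpolates m (beta lam)) w,
         (exists S : {linear ell2 R -> ell2 R},
            m_isometric_completion m lam S) <->
         (forall n : nat, (n + m <= k)%N ->
            \sum_(j < m.+1) (-1) ^+ j * 'C(m, j)%:R * beta lam (n + j) = 0) /\
         (forall n : nat, (m <= n)%N -> 0 < w.[n%:R]) &
         forall S : {linear ell2 R -> ell2 R},
           m_isometric_completion m lam S ->
           (strict_m_isometric_completion m lam S <-> size w = m)]).
Proof.
split=> [km mu mu_gt0|mk].
  have s_gt0 (x : R) : x \in lam ++ mu -> 0 < x.
    by rewrite mem_cat => /orP[/lam_gt0|/mu_gt0].
  have := exists_strict_completion_rcons s_gt0.
  (* lam ++ mu has m - 2 entries, so r is the weight of index m - 1. *)
  suff -> : (size (lam ++ mu)).+2 = m by [].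
  by rewrite size_cat !size_tuple -addn2 addnAC -subnDA (addnC 2%N) subnKC.
have mk1 : (m <= (size lam).+1)%N by rewrite size_tuple -ltnS -addn2.
have wb := interpolates_newton_poly m (beta lam).
exists (newton_poly m (beta lam)); split.
- exact: interpolates_unique.
- by have := completion_iff lam_gt0 mk1 wb; rewrite size_tuple.
- by move=> S; exact: strict_completion_iff.
Qed.
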